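(* For every real number $\lambda$ with $-\frac{2}{\sqrt{3}}<\lambda<0$, there exists a closed embedded curve in $\mathbb{R}^2$, not a circle, which satisfies $$k=-\langle x,N\rangle+\lambda$$ and whose image has $2$-symmetry.
   Context: For a smooth curve $x(s)\in\mathbb{R}^2$ parametrized by arc length $s$, let $T=\frac{dx}{ds}$ be the unit tangent vector, let $N$ be a continuous choice of unit normal vector along the curve (either of the two rotations of $T$ by $\pm\frac{\pi}{2}$, the same one along the whole curve), and let the curvature $k$ be defined by $\frac{dT}{ds}=kN$. Replacing $N$ by $-N$ changes $k$ to $-k$. A curve is a solution of the equation $k=-\langle x,N\rangle+\lambda$ if the equation holds at every point of the curve for a fixed such choice of $N$. A closed embedded curve is a smooth, regular, simple closed curve. A set in $\mathbb{R}^2$ admits $m$-symmetry ($m$ a positive integer) if it is invariant under the rotation by angle $\frac{2\pi}{m}$ about the origin. *)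

(* Defs.v *)
From Stdlib Require Import Reals.
From Coquelicot Require Import Coquelicot.
Open Scope R_scope.

Definition plane : Type := (R * R)%type.

Definition inner (p q : plane) : R := fst p * fst q + snd p * snd q.

Definition rotation (theta : R) (p : plane) : plane :=
  (cos theta * fst p - sin theta * snd p,
   sin theta * fst p + cos theta * snd p).

Definition smooth_function (f : R -> R) : Prop :=
  forall (n : nat) (s : R), ex_derive_n f n s.

Definition smooth_curve (x : R -> plane) : Prop :=
  smooth_function (fun s => fst (x s)) /\
  smooth_function (fun s => snd (x s)).

Definition is_velocity (x : R -> plane) (s : R) (v : plane) : Prop :=
  is_derive (fun t => fst (x t)) s (fst v) /\
  is_derive (fun t => snd (x t)) s (snd v).

Definition velocity (x : R -> plane) (s : R) : plane :=
  (Derive (fun t => fst (x t)) s, Derive (fun t => snd (x t)) s).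

Definition image (x : R -> plane) (p : plane) : Prop :=
  exists s : R, x s = p.

(* A closed curve is given by a periodic map on the whole line; injectivity on
   one period [0, L) makes L the minimal period and the curve simple. *)
Definition closed_embedded_curve (x : R -> plane) : Prop :=
  smooth_curve x /\
  (forall s, velocity x s <> (0, 0)) /\
  exists L : R, 0 < L /\
    (forall s, x (s + L) = x s) /\
    (forall s t, 0 <= s < L -> 0 <= t < L -> x s = x t -> s = t).

Definition arc_length_parametrized (x : R -> plane) : Prop :=
  forall s, inner (velocity x s) (velocity x s) = 1.

(* The angle is fixed before [s], so the same rotation of the tangent is used
   along the whole curve. *)
Definition is_unit_normal (x N : R -> plane) : Prop :=
  exists theta : R, (theta = PI / 2 \/ theta = - (PI / 2)) /\
    forall s, N s = rotation theta (velocity x s).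

(* dT/ds = k N, where T = dx/ds *)
Definition is_curvature (x N : R -> plane) (k : R -> R) : Prop :=
  forall s, is_velocity (velocity x) s (k s * fst (N s), k s * snd (N s)).

(* The equation k = - <x, N> + lambda, for an arc length parametrization. *)
Definition solves_equation (lambda : R) (x : R -> plane) : Prop :=
  arc_length_parametrized x /\
  exists (N : R -> plane) (k : R -> R),
    is_unit_normal x N /\
    is_curvature x N k /\
    forall s, k s = - inner (x s) (N s) + lambda.

Definition is_circle (S : plane -> Prop) : Prop :=
  exists (c : plane) (r : R), 0 < r /\
    forall p, S p <-> (fst p - fst c) ^ 2 + (snd p - snd c) ^ 2 = r ^ 2.

(* A rotation is a bijection, so the equivalence says that the rotated set is
   the set itself. *)
Definition admits_symmetry (m : nat) (S : plane -> Prop) : Prop :=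
  (0 < m)%nat /\
  forall p, S (rotation (2 * PI / INR m) p) <-> S p.

(* Main.v *)
Require Import Defs.
From Stdlib Require Import Reals Lra Lia Factorial ClassicalEpsilon.
From Coquelicot Require Import Coquelicot.
Open Scope R_scope.

(* With b = -lambda and theta the direction angle of T, the curvature satisfies
   k'' = 1/k - k - b in theta, with a convex potential minimal at the curvature
   k0 of the circle solution.  Let y be the signed square root of twice the
   potential and K its inverse, so that k = K(y).  At energy r^2/2 the phase
   (y, k') = (r sin phi, r cos phi) satisfies dtheta/dphi = K'(r sin phi), so one
   oscillation turns the tangent by Theta(r), the integral of K'(r sin phi) over
   [0, 2 pi].  As r -> 0, Theta(r) tends to 2 pi / sqrt(1 + 1/k0^2), which exceeds
   pi exactly when lambda > -2/sqrt 3; for large r, Theta(r) - pi behaves like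
   -2 b / r < 0.  Some r > 0 thus gives Theta(r) = pi, and the curve is convex,
   closes up after two oscillations and is invariant under x -> -x. *)

(** * Calculus *)

Lemma mean_value (f df : R -> R) (a b : R) :
  (forall x, is_derive f x (df x)) ->
  exists c, Rmin a b <= c <= Rmax a b /\ f b - f a = df c * (b - a).
Proof.
  intros Hf.
  apply MVT_gen; intros x _; [apply Hf|].
  apply derivable_continuous_pt; exists (df x); apply is_derive_Reals, Hf.
Qed.

Lemma mean_value_lt (f df : R -> R) (a b : R) :
  a < b -> (forall x, is_derive f x (df x)) ->
  exists c, a < c < b /\ f b - f a = df c * (b - a).
Proof.
  intros Hab Hf.
  destruct (MVT_cor2 f df a b Hab) as [c [E Hc]];
    [intros x _; apply is_derive_Reals, Hf|].
  exists c; split; [exact Hc|lra].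
Qed.

Lemma derive_pos_lt (f df : R -> R) (a b : R) :
  (forall x, is_derive f x (df x)) -> (forall x, 0 < df x) ->
  a < b -> f a < f b.
Proof.
  intros Hf Hp Hab.
  destruct (mean_value f df a b Hf) as [c [_ E]].
  specialize (Hp c); nra.
Qed.

Lemma derive_zero_eq (f : R -> R) (a b : R) :
  (forall x, is_derive f x 0) -> f a = f b.
Proof.
  intros Hf.
  destruct (mean_value f (fun _ => 0) a b Hf) as [c [_ E]]; lra.
Qed.

Lemma is_derive_continuous (f : R -> R) (x l : R) :
  is_derive f x l -> continuous f x.
Proof. intros H; apply (ex_derive_continuous f x); exists l; exact H. Qed.

(** Continuity of [g] comes from monotonicity: [f (g y - d) < y < f (g y + d)], so [g (y + h)] stays
    within [d] of [g y] for small [h]. By the mean value theorem the difference quotient equals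
    [/ df c] with [c] between [g y] and [g (y + h)], and [/ df] is continuous. *)
Lemma is_derive_inverse (f df g : R -> R) :
  (forall x, is_derive f x (df x)) ->
  (forall x, continuous df x) ->
  (forall x, 0 < df x) ->
  (forall y, f (g y) = y) ->
  forall y, is_derive g y (/ df (g y)).
Proof.
  intros Hf Hc Hp Hg y.
  assert (Hmono : forall a b, f a < f b -> a < b).
  { intros a b Hab; destruct (Rlt_le_dec a b) as [|Hba]; [assumption|].
    destruct Hba as [Hba|Hba]; [|subst; lra].
    pose proof (derive_pos_lt f df b a Hf Hp Hba); lra. }
  assert (Hci : continuous (fun x => / df x) (g y)).
  { apply continuous_comp; [apply Hc|].
    apply (ex_derive_continuous Rinv); auto_derive; specialize (Hp (g y)); lra. }
  apply is_derive_Reals; intros eps Heps.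
  apply continuity_pt_filterlim in Hci.
  destruct (Hci eps Heps) as [d [Hd HHd]].
  assert (H1 : f (g y - d) < y) by
    (rewrite <- (Hg y) at 2; apply (derive_pos_lt f df); auto; lra).
  assert (H2 : y < f (g y + d)) by
    (rewrite <- (Hg y) at 1; apply (derive_pos_lt f df); auto; lra).
  assert (Hdd : 0 < Rmin (y - f (g y - d)) (f (g y + d) - y)) by
    (apply Rmin_pos; lra).
  exists (mkposreal _ Hdd); intros h Hh0 Hh; simpl in Hh.
  pose proof (Rmin_l (y - f (g y - d)) (f (g y + d) - y)).
  pose proof (Rmin_r (y - f (g y - d)) (f (g y + d) - y)).
  apply Rabs_def2 in Hh.
  assert (G1 : g y - d < g (y + h)) by (apply Hmono; rewrite Hg; lra).
  assert (G2 : g (y + h) < g y + d) by (apply Hmono; rewrite Hg; lra).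
  destruct (mean_value f df (g y) (g (y + h)) Hf) as [c [Hcb E]].
  rewrite !Hg in E.
  pose proof (Hp c) as Hpc.
  replace ((g (y + h) - g y) / h) with (/ df c).
  2:{ assert (Eh : h = df c * (g (y + h) - g y)) by lra.
      assert (g (y + h) - g y <> 0) by (intros E0; rewrite E0 in Eh; lra).
      rewrite Eh at 2; field; lra. }
  destruct (Req_dec (g y) c) as [Ec|Ec].
  - rewrite Ec, Rminus_diag, Rabs_R0; exact Heps.
  - apply HHd; split; [split; [exact I|exact Ec]|].
    simpl; unfold Rdist.
    unfold Rmin, Rmax in Hcb; destruct (Rle_dec (g y) (g (y + h)));
    apply Rabs_def1; lra.
Qed.

(** The intermediate value theorem gives a preimage of each value, indefinite description picks one,
    and strict monotonicity makes the choice a left inverse too. *)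
Lemma increasing_inverse (f df : R -> R) :
  (forall x, is_derive f x (df x)) ->
  (forall x, continuous df x) ->
  (forall x, 0 < df x) ->
  (forall y, exists a b, f a <= y <= f b) ->
  exists g : R -> R,
    (forall y, f (g y) = y) /\ (forall x, g (f x) = x) /\
    (forall y, is_derive g y (/ df (g y))).
Proof.
  intros Hf Hc Hp Hs.
  assert (Hex : forall y, exists x, f x = y).
  { intros y; destruct (Hs y) as [a [b Hab]].
    destruct (IVT_gen f a b y) as [x [_ Hx]].
    - intros x; apply derivable_continuous_pt; exists (df x).
      apply is_derive_Reals, Hf.
    - rewrite Rmin_left, Rmax_right; lra.
    - exists x; exact Hx. }
  set (g := fun y => proj1_sig (constructive_indefinite_description _ (Hex y))).
  assert (Hg : forall y, f (g y) = y) by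
    (intros y; exact (proj2_sig (constructive_indefinite_description _ (Hex y)))).
  exists g; split; [exact Hg|split].
  - intros x; pose proof (Hg (f x)) as E.
    destruct (Rtotal_order (g (f x)) x) as [H|[H|H]]; [|exact H|];
      pose proof (derive_pos_lt f df _ _ Hf Hp H); lra.
  - apply (is_derive_inverse f); assumption.
Qed.

Lemma continuous_pos_lower_bound (f : R -> R) (a b : R) :
  a <= b -> (forall x, continuous f x) -> (forall x, 0 < f x) ->
  exists m, 0 < m /\ forall x, a <= x <= b -> m <= f x.
Proof.
  intros Hab Hc Hp.
  destruct (continuity_ab_min f a b Hab) as [x0 [Hx0 _]].
  { intros c _; apply continuity_pt_filterlim, Hc. }
  exists (f x0); split; [apply Hp|exact Hx0].
Qed.

Lemma continuous_upper_bound (f : R -> R) (a b : R) :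
  a <= b -> (forall x, continuous f x) ->
  exists M, forall x, a <= x <= b -> f x <= M.
Proof.
  intros Hab Hc.
  destruct (continuity_ab_maj f a b Hab) as [x0 [Hx0 _]].
  { intros c _; apply continuity_pt_filterlim, Hc. }
  exists (f x0); exact Hx0.
Qed.

Lemma is_derive_primitive (f : R -> R) (a x : R) :
  (forall y, continuous f y) -> is_derive (fun t => RInt f a t) x (f x).
Proof.
  intros Hc; apply (is_derive_RInt f _ a x); [|apply Hc].
  exists (mkposreal _ Rlt_0_1); intros y _.
  apply (RInt_correct f), (ex_RInt_continuous f); intros z _; apply Hc.
Qed.

Lemma ex_RInt_cont (f : R -> R) (a b : R) :
  (forall y, continuous f y) -> ex_RInt f a b.
Proof. intros Hc; apply (ex_RInt_continuous f); intros z _; apply Hc. Qed.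

Lemma RInt_primitive (f df : R -> R) (a b : R) :
  (forall x, is_derive f x (df x)) -> (forall x, continuous df x) ->
  RInt df a b = f b - f a.
Proof.
  intros Hf Hc; apply is_RInt_unique, (is_RInt_derive f df); auto.
Qed.

(** * The coordinate in which the potential is quadratic *)

(* The entire function (exp u - 1 - u) / u^2. *)
Definition exp_rem_coeff : nat -> R :=
  PS_decr_1 (PS_decr_1 (fun n => / INR (fact n))).
Definition exp_rem (u : R) : R := PSeries exp_rem_coeff u.
Definition exp_rem' (u : R) : R := PSeries (PS_derive exp_rem_coeff) u.

(** The infinite radius makes [exp_rem] differentiable everywhere, in particular at 0, where the
    quotient formula is undefined. *)
Lemma exp_rem_radius : CV_radius exp_rem_coeff = p_infty.
Proof.
  unfold exp_rem_coeff; rewrite !CV_radius_decr_1.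
  apply CV_radius_infinite_DAlembert.
  - intros n; apply Rinv_neq_0_compat, INR_fact_neq_0.
  - apply is_lim_seq_ext with (fun n => / INR (S n)).
    + intros n.
      rewrite Rabs_pos_eq.
      * rewrite fact_simpl, mult_INR; field; split;
          [apply INR_fact_neq_0|apply not_0_INR; lia].
      * apply Rlt_le, Rdiv_lt_0_compat; apply Rinv_0_lt_compat, INR_fact_lt_0.
    + replace (Finite 0) with (Rbar_inv p_infty) by reflexivity.
      apply is_lim_seq_inv; [|discriminate].
      apply (is_lim_seq_incr_1 INR), is_lim_seq_INR.
Qed.

Lemma is_derive_exp_rem (u : R) : is_derive exp_rem u (exp_rem' u).
Proof. apply is_derive_PSeries; rewrite exp_rem_radius; exact I. Qed.

Lemma continuous_exp_rem' (u : R) : continuous exp_rem' u.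
Proof.
  apply continuity_pt_filterlim, PSeries_continuity.
  rewrite CV_radius_derive, exp_rem_radius; exact I.
Qed.

Lemma exp_rem_spec (u : R) : exp u = 1 + u + u ^ 2 * exp_rem u.
Proof.
  assert (Ha : ex_pseries (fun n => / INR (fact n)) u) by
    (exists (exp u); apply is_exp_Reals).
  rewrite exp_Reals, PSeries_decr_1 by exact Ha.
  rewrite (PSeries_decr_1 (PS_decr_1 _)).
  - unfold exp_rem, exp_rem_coeff, PS_decr_1; simpl; field.
  - apply CV_radius_inside; rewrite CV_radius_decr_1.
    pose proof exp_rem_radius as E; unfold exp_rem_coeff in E.
    rewrite !CV_radius_decr_1 in E; rewrite E; exact I.
Qed.

Lemma exp_rem_0 : exp_rem 0 = / 2.
Proof.
  unfold exp_rem; rewrite PSeries_0.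
  unfold exp_rem_coeff, PS_decr_1; simpl; field.
Qed.

Lemma exp_rem_pos (u : R) : 0 < exp_rem u.
Proof.
  destruct (Req_dec u 0) as [->|Hu]; [rewrite exp_rem_0; lra|].
  pose proof (exp_ineq1 u Hu); pose proof (exp_rem_spec u).
  assert (0 < u ^ 2) by (apply pow2_gt_0; exact Hu).
  nra.
Qed.

Section Potential.

Variables b k0 : R.
Hypothesis b_pos : 0 < b.
Hypothesis k0_pos : 0 < k0.
Hypothesis k0_eq : k0 ^ 2 + b * k0 = 1.

(* In the variable u = ln (k / k0). *)
Definition potential (u : R) : R :=
  k0 ^ 2 * (exp u ^ 2 - 1) / 2 + b * k0 * (exp u - 1) - u.
(** The quotient [2 * potential u / u ^ 2], extended through [u = 0]. *)
Definition quot (u : R) : R :=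
  4 * k0 ^ 2 * exp_rem (2 * u) + 2 * b * k0 * exp_rem u.
Definition quot' (u : R) : R :=
  8 * k0 ^ 2 * exp_rem' (2 * u) + 2 * b * k0 * exp_rem' u.
(* A signed square root of [2 * potential], smooth through its double zero at 0. *)
Definition coord (u : R) : R := u * sqrt (quot u).
Definition coord' (u : R) : R := sqrt (quot u) + u * (quot' u / (2 * sqrt (quot u))).

Lemma exp_double (u : R) : exp (2 * u) = exp u ^ 2.
Proof. replace (2 * u) with (u + u) by ring; rewrite exp_plus; ring. Qed.

(** The terms linear in [u] cancel because [k0 ^ 2 + b * k0 = 1]; only the quadratic remainders of
    the two exponentials survive. *)
Lemma potential_quot (u : R) : 2 * potential u = u ^ 2 * quot u.
Proof.
  pose proof (exp_rem_spec u) as E1; pose proof (exp_rem_spec (2 * u)) as E2.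
  rewrite exp_double in E2; unfold potential, quot.
  assert (u ^ 2 * exp_rem u = exp u - 1 - u) by lra.
  assert (4 * (u ^ 2 * exp_rem (2 * u)) = exp u ^ 2 - 1 - 2 * u) by nra.
  transitivity (k0 ^ 2 * (4 * (u ^ 2 * exp_rem (2 * u))) +
    2 * b * k0 * (u ^ 2 * exp_rem u)); [|ring].
  rewrite H, H0.
  replace (k0 ^ 2 * (exp u ^ 2 - 1 - 2 * u) + 2 * b * k0 * (exp u - 1 - u)) with
    (k0 ^ 2 * (exp u ^ 2 - 1) + 2 * b * k0 * (exp u - 1) - 2 * u * (k0 ^ 2 + b * k0)) by ring.
  rewrite k0_eq; field.
Qed.

Lemma quot_pos (u : R) : 0 < quot u.
Proof.
  unfold quot; pose proof (exp_rem_pos u); pose proof (exp_rem_pos (2 * u)).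
  assert (0 < k0 ^ 2) by (apply pow_lt; exact k0_pos).
  assert (0 < b * k0) by (apply Rmult_lt_0_compat; assumption).
  nra.
Qed.

Lemma coord_sq (u : R) : coord u ^ 2 = 2 * potential u.
Proof.
  unfold coord; rewrite Rpow_mult_distr, pow2_sqrt by (apply Rlt_le, quot_pos).
  symmetry; apply potential_quot.
Qed.

Lemma is_derive_quot (u : R) : is_derive quot u (quot' u).
Proof.
  pose proof (is_derive_exp_rem u) as H1.
  pose proof (is_derive_exp_rem (2 * u)) as H2.
  unfold quot, quot'.
  auto_derive.
  - repeat split; [exists (exp_rem' (2 * u))|exists (exp_rem' u)]; assumption.
  - replace (Derive (fun x => exp_rem x) (2 * u)) with (exp_rem' (2 * u)) by
      (symmetry; apply is_derive_unique, H2).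
    replace (Derive (fun x => exp_rem x) u) with (exp_rem' u) by
      (symmetry; apply is_derive_unique, H1).
    ring.
Qed.

Lemma is_derive_coord (u : R) : is_derive coord u (coord' u).
Proof.
  pose proof (is_derive_quot u) as H; pose proof (quot_pos u) as Hp.
  unfold coord; auto_derive.
  - repeat split; [exists (quot' u); exact H|exact Hp].
  - replace (Derive (fun x => quot x) u) with (quot' u) by
      (symmetry; apply is_derive_unique, H).
    unfold coord'; field; apply Rgt_not_eq, sqrt_lt_R0, Hp.
Qed.

Lemma continuous_coord' (u : R) : continuous coord' u.
Proof.
  assert (Hq : continuous (fun u => sqrt (quot u)) u).
  { apply (continuous_comp quot sqrt);
      [apply is_derive_continuous with (1 := is_derive_quot u)|].
    apply continuity_pt_filterlim, continuity_pt_sqrt, Rlt_le, quot_pos. }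
  assert (Hs : 0 < sqrt (quot u)) by apply sqrt_lt_R0, quot_pos.
  unfold coord'; apply (continuous_plus (fun u => sqrt (quot u))); [exact Hq|].
  apply (continuous_mult (fun u : R => u)); [apply continuous_id|].
  apply (continuous_mult quot').
  - unfold quot'; apply (continuous_plus (fun u => 8 * k0 ^ 2 * exp_rem' (2 * u))).
    + apply (continuous_scal_r (8 * k0 ^ 2) (fun u => exp_rem' (2 * u))).
      apply (continuous_comp (fun u => 2 * u) exp_rem'); [|apply continuous_exp_rem'].
      apply (continuous_scal_r 2 (fun u : R => u)), continuous_id.
    + apply (continuous_scal_r (2 * b * k0) exp_rem'), continuous_exp_rem'.
  - apply (continuous_comp (fun u => 2 * sqrt (quot u)) Rinv).
    + apply (continuous_scal_r 2 (fun u => sqrt (quot u))), Hq.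
    + apply (ex_derive_continuous Rinv); auto_derive; lra.
Qed.

Lemma is_derive_potential (u : R) :
  is_derive potential u ((k0 * exp u) ^ 2 + b * (k0 * exp u) - 1).
Proof. unfold potential; auto_derive; [exact I|field]. Qed.

(** Both sides are the derivative of [potential], once written as [coord ^ 2 / 2] and once computed
    directly. *)
Lemma coord_coord' (u : R) :
  coord u * coord' u = (k0 * exp u) ^ 2 + b * (k0 * exp u) - 1.
Proof.
  assert (H1 : is_derive (fun u => coord u ^ 2 / 2) u (coord u * coord' u)).
  { pose proof (is_derive_coord u) as H; auto_derive; [exists (coord' u); exact H|].
    replace (Derive (fun x => coord x) u) with (coord' u) by
      (symmetry; apply is_derive_unique, H).
    field. }
  apply is_derive_unique in H1; rewrite <- H1.
  apply is_derive_unique.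
  assert (E : forall t, potential t = coord t ^ 2 / 2) by
    (intros t; rewrite coord_sq; field).
  apply (is_derive_ext potential _ u _ E).
  apply is_derive_potential.
Qed.

Lemma coord_0 : coord 0 = 0.
Proof. unfold coord; ring. Qed.

Lemma coord'_0 : coord' 0 = sqrt (1 + k0 ^ 2).
Proof.
  unfold coord'; rewrite Rmult_0_l, Rplus_0_r; f_equal.
  unfold quot; rewrite Rmult_0_r, !exp_rem_0; lra.
Qed.

(** For [u <> 0], [coord u] has the sign of [u], and so has [coord u * coord' u], because k^2 + b k
    increases in k > 0 and equals 1 at [k0]. *)
Lemma coord'_pos (u : R) : 0 < coord' u.
Proof.
  destruct (Req_dec u 0) as [->|Hu].
  { rewrite coord'_0; apply sqrt_lt_R0; nra. }
  assert (Hs : 0 < sqrt (quot u)) by apply sqrt_lt_R0, quot_pos.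
  assert (H : 0 < u * (coord u * coord' u)).
  { rewrite coord_coord'.
    destruct (Rtotal_order u 0) as [H|[H|H]]; [|lra|].
    - pose proof (exp_increasing u 0 H) as He; rewrite exp_0 in He.
      pose proof (exp_pos u).
      assert (k0 * exp u < k0) by nra.
      assert (0 < k0 * exp u) by nra.
      assert ((k0 * exp u) ^ 2 + b * (k0 * exp u) < 1) by nra.
      nra.
    - pose proof (exp_increasing 0 u H) as He; rewrite exp_0 in He.
      assert (k0 < k0 * exp u) by nra.
      assert (1 < (k0 * exp u) ^ 2 + b * (k0 * exp u)) by nra.
      nra. }
  unfold coord in H.
  assert (0 < u ^ 2) by (apply pow2_gt_0; exact Hu).
  assert (0 < u ^ 2 * sqrt (quot u)) by (apply Rmult_lt_0_compat; assumption).
  nra.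
Qed.

Lemma coord_onto (y : R) : exists a c, coord a <= y <= coord c.
Proof.
  assert (Hinc : forall a c, a < c -> coord a < coord c).
  { intros a c; apply (derive_pos_lt coord coord'); [apply is_derive_coord|apply coord'_pos]. }
  (* With this [a] the term [- 2 * a] of [coord a ^ 2] is [y ^ 2] plus exactly what offsets the
     negative constants. On the other side [quot c >= k0 ^ 2] gives
     [coord c ^ 2 >= c ^ 2 * k0 ^ 2 = y ^ 2]. *)
  set (a := - (y ^ 2 / 2 + k0 ^ 2 / 2 + b * k0)).
  set (c := Rabs y / k0).
  assert (Ha : a < 0).
  { unfold a; assert (0 < b * k0) by nra; nra. }
  assert (Hc : 0 <= c).
  { unfold c; apply Rdiv_le_0_compat; [apply Rabs_pos|assumption]. }
  pose proof coord_0 as C0.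
  exists a, c; split.
  - pose proof (Hinc a 0 Ha) as Hneg; rewrite C0 in Hneg.
    pose proof (coord_sq a) as Hsq; unfold potential in Hsq.
    pose proof (exp_pos a).
    assert (0 < b * k0) by nra.
    assert (y ^ 2 <= coord a ^ 2).
    { rewrite Hsq; unfold a at 3.
      assert (0 <= k0 ^ 2 * exp a ^ 2) by (apply Rmult_le_pos; apply pow2_ge_0).
      assert (0 <= b * k0 * exp a) by nra.
      nra. }
    destruct (Rle_lt_dec (coord a) y); [assumption|exfalso; nra].
  - destruct Hc as [Hc|Hc].
    + pose proof (Hinc 0 c Hc) as Hpos; rewrite C0 in Hpos.
      pose proof (coord_sq c) as Hsq.
      rewrite potential_quot in Hsq.
      assert (Hq : k0 ^ 2 <= quot c).
      (* From exp (2 c) >= (1 + c)^2 one gets exp (2 c) - 1 - 2 c >= c^2. *)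
      { assert (He : / 4 <= exp_rem (2 * c)).
        { pose proof (exp_rem_spec c) as E1; pose proof (exp_rem_spec (2 * c)) as E2.
          rewrite exp_double in E2.
          pose proof (exp_ineq1 c ltac:(lra)).
          assert (0 < c ^ 2) by (apply pow2_gt_0; lra).
          assert (c ^ 2 <= 4 * c ^ 2 * exp_rem (2 * c)) by nra.
          nra. }
        unfold quot; pose proof (exp_rem_pos c).
        assert (0 < b * k0) by nra.
        assert (0 < k0 ^ 2) by nra.
        nra. }
      assert (c ^ 2 * k0 ^ 2 = y ^ 2).
      { unfold c; rewrite <- (pow2_abs y); field; lra. }
      assert (y ^ 2 <= coord c ^ 2) by nra.
      destruct (Rle_lt_dec y (coord c)); [assumption|exfalso; nra].
    + rewrite <- Hc, C0.
      unfold c in Hc; symmetry in Hc.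
      destruct (Rle_lt_dec y 0); [assumption|exfalso].
      rewrite Rabs_pos_eq in Hc by lra.
      pose proof (Rdiv_lt_0_compat y k0 r k0_pos); lra.
Qed.

(* [K] inverts [coord] in the curvature variable k = k0 exp u. *)
Lemma curvature_profile :
  exists K dK : R -> R,
    (forall y, 0 < K y) /\
    (forall y, 0 < dK y) /\
    (forall y, is_derive K y (dK y)) /\
    (forall y, continuous dK y) /\
    (forall y, y * K y = dK y * (K y ^ 2 + b * K y - 1)) /\
    (forall y, y ^ 2 = K y ^ 2 - k0 ^ 2 + 2 * b * (K y - k0) - 2 * ln (K y / k0)) /\
    K 0 = k0 /\
    dK 0 = k0 / sqrt (1 + k0 ^ 2).
Proof.
  destruct (increasing_inverse coord coord' is_derive_coord continuous_coord'
    coord'_pos coord_onto) as [W [HFW [HWF HW]]].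
  exists (fun y => k0 * exp (W y)), (fun y => k0 * exp (W y) / coord' (W y)).
  assert (HW0 : W 0 = 0) by (pose proof (HWF 0) as E; rewrite coord_0 in E; exact E).
  split; [|split; [|split; [|split; [|split; [|split; [|split]]]]]].
  - intros y; apply Rmult_lt_0_compat; [assumption|apply exp_pos].
  - intros y; apply Rdiv_lt_0_compat; [|apply coord'_pos].
    apply Rmult_lt_0_compat; [assumption|apply exp_pos].
  - intros y; pose proof (HW y) as H; auto_derive; [eexists; exact H|].
    replace (Derive (fun x => W x) y) with (/ coord' (W y)) by
      (symmetry; apply is_derive_unique, H).
    field; apply Rgt_not_eq, coord'_pos.
  - intros y.
    assert (HWc : continuous W y) by apply (is_derive_continuous _ _ _ (HW y)).
    apply (continuous_mult (fun y => k0 * exp (W y)) (fun y => / coord' (W y))).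
    + apply (continuous_scal_r k0 (fun y => exp (W y))).
      apply (continuous_comp W exp); [exact HWc|].
      apply (ex_derive_continuous exp); auto_derive; exact I.
    + apply (continuous_comp W (fun u => / coord' u)); [exact HWc|].
      apply (continuous_comp coord' Rinv); [apply continuous_coord'|].
      apply (ex_derive_continuous Rinv); auto_derive; apply Rgt_not_eq, coord'_pos.
  - intros y; rewrite <- coord_coord', HFW.
    field; apply Rgt_not_eq, coord'_pos.
  - intros y; rewrite <- (HFW y) at 1; rewrite coord_sq; unfold potential.
    replace (k0 * exp (W y) / k0) with (exp (W y)) by (field; lra).
    rewrite ln_exp; field.
  - rewrite HW0, exp_0; ring.
  - rewrite HW0, exp_0, coord'_0; unfold Rdiv; ring.
Qed.

End Potential.

(** * The angle turned during one oscillation *)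

Lemma continuous_scaled_sin (f : R -> R) (r x : R) :
  (forall y, continuous f y) -> continuous (fun u => f (r * sin u)) x.
Proof.
  intros Hf; apply (continuous_comp (fun u => r * sin u) f); [|apply Hf].
  apply (ex_derive_continuous (fun u => r * sin u)); auto_derive; exact I.
Qed.

(** For [r'] within 1 of [r], all arguments of [f] lie in the compact interval [-M, M], where [f] is
    uniformly continuous. *)
Lemma continuous_RInt_scaled_sin (f : R -> R) (a b r : R) :
  a <= b -> (forall y, continuous f y) ->
  continuous (fun r => RInt (fun u => f (r * sin u)) a b) r.
Proof.
  intros Hab Hf.
  apply continuity_pt_filterlim; intros eps Heps.
  set (M := Rabs r + 1).
  assert (Hu : uniform_continuity f (fun y => - M <= y <= M)).
  { apply Heine; [apply compact_P3|].
    intros x _; apply continuity_pt_filterlim, Hf. }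
  (* The added 1 allows [a = b] and makes the final inequality strict. *)
  assert (He : 0 < eps / (b - a + 1)) by (apply Rdiv_lt_0_compat; lra).
  destruct (Hu (mkposreal _ He)) as [d Hd]; simpl in Hd.
  exists (Rmin d 1); split; [apply Rmin_pos; [apply cond_pos|lra]|].
  intros r' [_ Hr]; simpl in Hr |- *; unfold Rdist in *.
  pose proof (Rmin_l d 1); pose proof (Rmin_r d 1).
  assert (E : RInt (fun u => f (r' * sin u)) a b - RInt (fun u => f (r * sin u)) a b =
    RInt (fun u => f (r' * sin u) - f (r * sin u)) a b).
  { symmetry; apply (RInt_minus (fun u => f (r' * sin u)) (fun u => f (r * sin u)));
      apply ex_RInt_cont; intros y; apply continuous_scaled_sin, Hf. }
  rewrite E.
  apply Rle_lt_trans with ((b - a) * (eps / (b - a + 1))).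
  2:{ apply Rmult_lt_reg_r with (b - a + 1); [lra|].
      replace ((b - a) * (eps / (b - a + 1)) * (b - a + 1)) with ((b - a) * eps) by
        (field; lra).
      nra. }
  apply abs_RInt_le_const; [exact Hab| |].
  - apply ex_RInt_cont; intros y.
    apply (continuous_minus (fun u => f (r' * sin u)) (fun u => f (r * sin u)));
      apply continuous_scaled_sin, Hf.
  - intros t _; apply Rlt_le.
    pose proof (SIN_bound t) as Hs.
    assert (Hs' : Rabs (sin t) <= 1) by (apply Rabs_le; lra).
    assert (Hrr : Rabs r' <= M).
    { unfold M; replace r' with (r + (r' - r)) by ring.
      eapply Rle_trans; [apply Rabs_triang|]; lra. }
    assert (Hin : forall z, Rabs z <= M -> - M <= z * sin t <= M).
    { intros z Hz; apply Rabs_le_between; rewrite Rabs_mult.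
      pose proof (Rabs_pos z); pose proof (Rabs_pos (sin t)); nra. }
    apply Hd.
    + apply Hin, Hrr.
    + apply Hin; unfold M; lra.
    + replace (r' * sin t - r * sin t) with ((r' - r) * sin t) by ring.
      rewrite Rabs_mult; pose proof (Rabs_pos (r' - r)); pose proof (Rabs_pos (sin t)); nra.
Qed.

Lemma sq_exp_neg_le (z : R) : 0 <= z -> z ^ 2 * exp (- z) <= 4.
Proof.
  intros Hz.
  assert (H : z ^ 2 <= 4 * exp z).
  { pose proof (exp_ineq1_le (z / 2)).
    replace (exp z) with (exp (z / 2) ^ 2).
    2:{ simpl; rewrite Rmult_1_r, <- exp_plus; f_equal; field. }
    nra. }
  rewrite exp_Ropp; pose proof (exp_pos z).
  apply Rmult_le_reg_r with (exp z); [assumption|].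
  rewrite Rmult_assoc, Rinv_l; lra.
Qed.

Lemma ln_le_linear (x : R) : 0 < x -> ln x <= x.
Proof.
  intros Hx; pose proof (exp_ineq1_le (ln x)) as H.
  rewrite exp_ln in H by exact Hx; lra.
Qed.

Section TotalAngle.

Variables (b k0 : R) (K dK : R -> R).
Hypothesis b_pos : 0 < b.
Hypothesis k0_pos : 0 < k0.
Hypothesis k0_eq : k0 ^ 2 + b * k0 = 1.
Hypothesis K_pos : forall y, 0 < K y.
Hypothesis dK_pos : forall y, 0 < dK y.
Hypothesis is_derive_K : forall y, is_derive K y (dK y).
Hypothesis continuous_dK : forall y, continuous dK y.
Hypothesis K_dK : forall y, y * K y = dK y * (K y ^ 2 + b * K y - 1).
Hypothesis K_energy :
  forall y, y ^ 2 = K y ^ 2 - k0 ^ 2 + 2 * b * (K y - k0) - 2 * ln (K y / k0).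
Hypothesis K_0 : K 0 = k0.

(** * Behaviour of the profile [K] and of its derivative far from 0 *)

Lemma K_lt (x y : R) : x < y -> K x < K y.
Proof. apply (derive_pos_lt K dK); assumption. Qed.

(** For [K y >= k0] the logarithm in the energy relation is nonnegative, so y^2 <= K^2 + 2 b K <= (K
    + b)^2. *)
Lemma K_ge (y : R) : 0 <= y -> y <= K y + b /\ k0 <= K y.
Proof.
  intros Hy.
  assert (Hk : k0 <= K y).
  { rewrite <- K_0; destruct Hy as [Hy|<-]; [apply Rlt_le, K_lt, Hy|lra]. }
  split; [|exact Hk].
  pose proof (K_energy y) as E.
  assert (Hl : 0 <= ln (K y / k0)).
  { rewrite <- ln_1; apply ln_le; [lra|].
    apply Rmult_le_reg_r with k0; [assumption|]; field_simplify; lra. }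
  destruct (Rle_lt_dec y (K y + b)); [assumption|exfalso].
  pose proof (K_pos y); nra.
Qed.

(** Since y K <= K^2 + b K, the relation [K_dK] gives (dK - 1) (K^2 + b K - 1) <= 1, and the second
    factor is at least y^2 / 4. *)
Lemma dK_pos_side (y : R) :
  2 * b + 2 <= y -> y ^ 2 * (dK y - 1) <= 4.
Proof.
  intros Hy.
  destruct (K_ge y ltac:(lra)) as [H1 _].
  pose proof (K_dK y) as E; pose proof (dK_pos y).
  set (k := K y) in *; set (d := dK y) in *.
  assert (Hk : y / 2 + 1 <= k) by lra.
  assert (Hq : y ^ 2 / 4 <= k ^ 2 + b * k - 1) by nra.
  assert (Hd : (d - 1) * (k ^ 2 + b * k - 1) <= 1) by nra.
  destruct (Rle_lt_dec d 1); nra.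
Qed.

(** Below [k0] all other terms of the energy relation have a sign that forces ln (K / k0) <= - y^2 /
    2. So [K (- y)] has Gaussian decay, and [dK (- y)] is at most [2 * y] times it. *)
Lemma dK_neg_side (y : R) :
  4 <= y -> y ^ 2 * dK (- y) <= 32 * k0.
Proof.
  intros Hy.
  pose proof (K_energy (- y)) as E; pose proof (K_dK (- y)) as E'.
  pose proof (K_pos (- y)) as Hk; pose proof (dK_pos (- y)) as Hd.
  assert (Hlt : K (- y) < k0) by (rewrite <- K_0; apply K_lt; lra).
  set (k := K (- y)) in *; set (d := dK (- y)) in *.
  assert (Hke : k <= k0 * exp (- (y ^ 2 / 2))).
  { assert (Hl : ln (k / k0) <= - (y ^ 2 / 2)).
    { assert (b * (k - k0) < 0) by nra.
      assert (k ^ 2 < k0 ^ 2) by nra.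
      nra. }
    assert (Hp : 0 < k / k0) by (apply Rdiv_lt_0_compat; assumption).
    replace k with (k0 * (k / k0)) by (field; lra).
    apply Rmult_le_compat_l; [lra|].
    rewrite <- (exp_ln (k / k0)) by exact Hp.
    destruct Hl as [Hl|Hl]; [apply Rlt_le, exp_increasing, Hl|rewrite Hl; lra]. }
  pose proof (sq_exp_neg_le (y ^ 2 / 2) ltac:(nra)) as Hs.
  set (e := exp (- (y ^ 2 / 2))) in *.
  assert (He : 0 < e) by apply exp_pos.
  assert (Hy4 : y ^ 4 * e <= 16) by (replace (y ^ 4 * e) with (4 * ((y ^ 2 / 2) ^ 2 * e)) by field; lra).
  assert (H256 : 256 <= y ^ 4) by (replace (y ^ 4) with ((y ^ 2) ^ 2) by ring; assert (16 <= y ^ 2) by nra; nra).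
  assert (Hke2 : k <= k0 / 2) by nra.
  (* With [k <= k0 / 2], b k + k^2 is at most half of b k0 + k0^2 = 1. *)
  assert (Hq : / 2 <= 1 - b * k - k ^ 2) by nra.
  assert (Hdk : d <= 2 * y * k) by nra.
  assert (0 <= k0 * e) by nra.
  apply Rle_trans with (2 * (y ^ 3 * k)).
  { replace (2 * (y ^ 3 * k)) with (y ^ 2 * (2 * y * k)) by ring.
    apply Rmult_le_compat_l; [apply pow2_ge_0|assumption]. }
  assert (Hy3 : 0 <= y ^ 3) by (apply pow_le; lra).
  apply Rle_trans with (2 * (y ^ 3 * (k0 * e))); [nra|].
  apply Rle_trans with (2 * (y ^ 4 * (k0 * e))).
  { assert (y ^ 3 <= y ^ 4) by (simpl in *; nra). nra. }
  nra.
Qed.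

(** Opposite phases are paired; 1 is the mean value of the pair for which [quarter_angle] is exactly
    [PI / 2]. *)
Definition excess (y : R) : R := dK y + dK (- y) - 1.

Lemma continuous_excess (y : R) : continuous excess y.
Proof.
  unfold excess; apply (continuous_minus (fun y => dK y + dK (- y)) (fun _ => 1));
    [|apply continuous_const].
  apply (continuous_plus dK); [apply continuous_dK|].
  apply (continuous_comp Ropp dK); [|apply continuous_dK].
  apply (ex_derive_continuous Ropp); auto_derive; exact I.
Qed.

Lemma excess_bound : exists C, forall y, 0 <= y -> y ^ 2 * excess y <= C.
Proof.
  (* Beyond [Y] both tail estimates apply, as [Y] exceeds [2 * b + 2] and 4; up to [Y] continuity
     suffices. *)
  set (Y := 2 * b + 4).
  destruct (continuous_upper_bound (fun y => y ^ 2 * excess y) 0 Y) as [M HM].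
  - unfold Y; lra.
  - intros x; apply (continuous_mult (fun y => y ^ 2) excess); [|apply continuous_excess].
    apply (ex_derive_continuous (fun y => y ^ 2)); auto_derive; exact I.
  - exists (Rmax M (4 + 32 * k0)); intros y Hy.
    destruct (Rle_lt_dec y Y) as [H|H].
    + eapply Rle_trans; [apply HM; lra|apply Rmax_l].
    + eapply Rle_trans; [|apply Rmax_r].
      unfold Y in H.
      pose proof (dK_pos_side y ltac:(lra)); pose proof (dK_neg_side y ltac:(lra)).
      unfold excess; nra.
Qed.

Definition excess_primitive (y : R) : R := K y - K (- y) - y.

Lemma is_derive_excess_primitive (y : R) : is_derive excess_primitive y (excess y).
Proof.
  pose proof (is_derive_K y) as H1; pose proof (is_derive_K (- y)) as H2.
  unfold excess_primitive, excess; auto_derive.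
  - repeat split; [exists (dK y)|exists (dK (- y))]; assumption.
  - replace (Derive (fun x => K x) y) with (dK y) by
      (symmetry; apply is_derive_unique, H1).
    replace (Derive (fun x => K x) (- y)) with (dK (- y)) by
      (symmetry; apply is_derive_unique, H2).
    ring.
Qed.

(** At large [r] the term 2 b K of the energy relation dominates the logarithm and the constants, so
    r^2 >= (K + b / 2)^2 and r exceeds K by at least b / 2. *)
Lemma excess_primitive_large :
  exists r0, forall r, 0 <= r -> r0 <= r -> excess_primitive r <= - (b / 2).
Proof.
  (* [A] collects the constants, with b^2 to spare. Since [K r >= r - b], the threshold below yields
     [2 * A <= b * K r]. *)
  set (A := (k0 + b) ^ 2 + 2 * ln (4 / (b * k0))).
  exists (2 * A / b + b); intros r Hr0 Hr.
  destruct (K_ge r Hr0) as [Hk _].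
  pose proof (K_pos r) as Hkp; pose proof (K_pos (- r)).
  pose proof (K_energy r) as E.
  assert (Hbk : 0 < b * k0) by nra.
  assert (Hl : ln (K r / k0) <= b / 4 * K r + ln (4 / (b * k0))).
  { replace (K r / k0) with (b / 4 * K r * (4 / (b * k0))) by (field; lra).
    assert (0 < b / 4 * K r) by nra.
    rewrite ln_mult; [|assumption|apply Rdiv_lt_0_compat; lra].
    apply Rplus_le_compat_r, ln_le_linear; assumption. }
  assert (HA : 2 * A <= b * K r).
  { apply Rle_trans with (b * (2 * A / b)); [right; field; lra|].
    apply Rmult_le_compat_l; lra. }
  unfold A in HA; unfold excess_primitive.
  assert (Hsq : (K r + b / 2) ^ 2 <= r ^ 2) by nra.
  destruct (Rle_lt_dec (K r + b / 2) r); [lra|exfalso; nra].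
Qed.

(** Half of the angle turned in one oscillation, by the symmetries of sin; the target value is
    therefore [PI / 2]. *)
Definition quarter_angle (r : R) : R :=
  RInt (fun u => dK (r * sin u) + dK (- (r * sin u))) 0 (PI / 2).

Lemma quarter_angle_excess (r : R) :
  quarter_angle r = PI / 2 + RInt (fun u => excess (r * sin u)) 0 (PI / 2).
Proof.
  assert (H : RInt (fun _ => 1) 0 (PI / 2) = PI / 2).
  { rewrite RInt_const; unfold scal; simpl; unfold mult; simpl; ring. }
  rewrite <- H at 1.
  rewrite <- (RInt_plus (fun _ => 1) (fun u => excess (r * sin u))).
  - apply RInt_ext; intros u _; unfold excess, plus; simpl; ring.
  - apply ex_RInt_const.
  - apply ex_RInt_cont; intros y; apply continuous_scaled_sin, continuous_excess.
Qed.

(* Up to an error of order r^-2 the weight 1 may be replaced by cos u, and then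
   the integrand is the derivative of [excess_primitive (r sin u) / r]. *)
Lemma quarter_angle_large : exists r, 0 < r /\ quarter_angle r < PI / 2.
Proof.
  destruct excess_bound as [C0 HC0].
  destruct excess_primitive_large as [r0 Hr0].
  pose proof PI_RGT_0 as Hpi.
  set (C := Rmax C0 0).
  assert (HC : 0 <= C) by apply Rmax_r.
  assert (HC1 : forall y, 0 <= y -> y ^ 2 * excess y <= C) by
    (intros y Hy; eapply Rle_trans; [apply HC0, Hy|apply Rmax_l]).
  (* Large enough for [r0 <= r] and for [C * PI < b * r], which makes the main term beat the
     error. *)
  set (r := Rmax r0 0 + C * PI / b + 1).
  assert (Hcb : 0 <= C * PI / b) by (apply Rdiv_le_0_compat; nra).
  pose proof (Rmax_l r0 0); pose proof (Rmax_r r0 0).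
  assert (Hr : 1 <= r) by (unfold r; lra).
  exists r; split; [lra|].
  rewrite quarter_angle_excess.
  assert (Hs : excess_primitive r <= - (b / 2)) by (apply Hr0; unfold r; lra).
  assert (Hcont : forall y, continuous (fun u => excess (r * sin u)) y) by
    (intros y; apply continuous_scaled_sin, continuous_excess).
  assert (Hcos : forall y, continuous cos y) by
    (intros y; apply (ex_derive_continuous cos); auto_derive; exact I).
  assert (Hc1 : forall y, continuous (fun u => cos u * excess (r * sin u)) y) by
    (intros y; apply (continuous_mult cos); auto).
  assert (E : excess_primitive r / r =
    RInt (fun u => cos u * excess (r * sin u)) 0 (PI / 2)).
  { rewrite (RInt_primitive (fun u => excess_primitive (r * sin u) / r)).
    - rewrite sin_PI2, sin_0, Rmult_1_r, Rmult_0_r.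
      unfold excess_primitive at 3; rewrite Ropp_0; field; lra.
    - intros u; pose proof (is_derive_excess_primitive (r * sin u)) as H1.
      auto_derive; [eexists; exact H1|].
      replace (Derive (fun x => excess_primitive x) (r * sin u)) with (excess (r * sin u)) by
        (symmetry; apply is_derive_unique, H1).
      field; lra.
    - exact Hc1. }
  assert (Hle : RInt (fun u => excess (r * sin u)) 0 (PI / 2) <=
    RInt (fun u => cos u * excess (r * sin u) + C / r ^ 2) 0 (PI / 2)).
  { apply RInt_le; [lra|apply ex_RInt_cont, Hcont| |].
    - apply ex_RInt_cont; intros y.
      apply (continuous_plus (fun u => cos u * excess (r * sin u)));
        [apply Hc1|apply continuous_const].
    - intros u Hu.
      assert (Hsin : 0 < sin u) by (apply sin_gt_0; lra).
      assert (Hcu : 0 < cos u) by (apply cos_gt_0; lra).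
      pose proof (sin2_cos2 u) as Hsc; unfold Rsqr in Hsc.
      pose proof (HC1 (r * sin u) ltac:(nra)) as Hb.
      pose proof (COS_bound u).
      set (D := excess (r * sin u)) in *.
      assert (Hr2 : 0 < r ^ 2) by nra.
      assert (Hcr : C = C / r ^ 2 * r ^ 2) by (field; lra).
      assert (0 <= C / r ^ 2) by (apply Rdiv_le_0_compat; assumption).
      set (q := C / r ^ 2) in *.
      assert (Hb' : sin u ^ 2 * D <= q).
      { apply Rmult_le_reg_r with (r ^ 2); [assumption|].
        rewrite <- Hcr; eapply Rle_trans; [|exact Hb]; right; ring. }
      (* If D <= 0 then D <= D cos u. Otherwise 1 - cos u <= sin^2 u gives D (1 - cos u) <= D sin^2
         u <= q. *)
      destruct (Rle_lt_dec D 0); nra. }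
  rewrite (RInt_plus (fun u => cos u * excess (r * sin u)) (fun _ => C / r ^ 2)) in Hle;
    [|apply ex_RInt_cont, Hc1|apply ex_RInt_const].
  rewrite <- E, RInt_const in Hle.
  unfold scal, plus in Hle; simpl in Hle; unfold mult in Hle; simpl in Hle.
  assert (Hneg : excess_primitive r / r + (PI / 2 - 0) * (C / (r * (r * 1))) < 0); [|lra].
  replace (excess_primitive r / r + (PI / 2 - 0) * (C / (r * (r * 1)))) with
    ((r * excess_primitive r + PI * C / 2) / r ^ 2) by (field; lra).
  assert (Hbr : C * PI < b * r).
  { apply Rlt_le_trans with (b * (C * PI / b + 1)).
    - replace (b * (C * PI / b + 1)) with (C * PI + b) by (field; lra); lra.
    - apply Rmult_le_compat_l; unfold r; lra. }
  apply Rdiv_neg_pos; nra.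
Qed.

Lemma continuous_quarter_angle (r : R) : continuous quarter_angle r.
Proof.
  apply (continuous_RInt_scaled_sin (fun y => dK y + dK (- y)) 0 (PI / 2));
    [pose proof PI_RGT_0; lra|].
  intros y; apply (continuous_plus dK); [apply continuous_dK|].
  apply (continuous_comp Ropp dK); [|apply continuous_dK].
  apply (ex_derive_continuous Ropp); auto_derive; exact I.
Qed.

(** At [r = 0] the integrand is constant and [quarter_angle 0 = PI * dK 0 > PI / 2]; the
    intermediate value theorem applies between 0 and the large [r] found above. *)
Lemma quarter_angle_attained :
  / 2 < dK 0 -> exists r, 0 < r /\ quarter_angle r = PI / 2.
Proof.
  intros H0; pose proof PI_RGT_0 as Hpi.
  destruct quarter_angle_large as [r1 [Hr1 Hq1]].
  assert (Hq0 : PI / 2 < quarter_angle 0).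
  { unfold quarter_angle.
    rewrite (RInt_ext _ (fun _ => dK 0 + dK 0)).
    - rewrite RInt_const; unfold scal; simpl; unfold mult; simpl; nra.
    - intros u _; rewrite Rmult_0_l, Ropp_0; reflexivity. }
  destruct (IVT_gen quarter_angle 0 r1 (PI / 2)) as [r [Hr E]].
  - intros r; apply continuity_pt_filterlim, continuous_quarter_angle.
  - rewrite Rmin_right, Rmax_left; lra.
  - exists r; split; [|exact E].
    rewrite Rmin_left in Hr by lra.
    destruct (Req_dec r 0) as [->|]; lra.
Qed.

End TotalAngle.

(** * The periodic orbit *)

Section SinPrimitive.

Variable r : R.

Definition sin_primitive (f : R -> R) (x : R) : R :=
  RInt (fun u => f (r * sin u)) 0 x.

Lemma is_derive_sin_primitive (f : R -> R) (x : R) :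
  (forall y, continuous f y) -> is_derive (sin_primitive f) x (f (r * sin x)).
Proof.
  intros Hf; apply (is_derive_primitive (fun u => f (r * sin u))).
  intros y; apply continuous_scaled_sin, Hf.
Qed.

Lemma sin_primitive_0 (f : R -> R) : sin_primitive f 0 = 0.
Proof. apply (RInt_point 0 (fun u => f (r * sin u))). Qed.

Lemma sin_primitive_PI (f : R -> R) :
  (forall y, continuous f y) ->
  sin_primitive f PI = 2 * sin_primitive f (PI / 2).
Proof.
  intros Hf.
  assert (H : sin_primitive f (PI - 0) + sin_primitive f 0 =
    sin_primitive f (PI - PI / 2) + sin_primitive f (PI / 2)).
  { apply (derive_zero_eq (fun x => sin_primitive f (PI - x) + sin_primitive f x)).
    intros x.
    pose proof (is_derive_sin_primitive f x Hf) as H1.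
    pose proof (is_derive_sin_primitive f (PI - x) Hf) as H2.
    auto_derive; [repeat split; eexists; eassumption|].
    replace (Derive (fun x => sin_primitive f x) x) with (f (r * sin x)) by
      (symmetry; apply is_derive_unique, H1).
    replace (Derive (fun x => sin_primitive f x) (PI + - x)) with (f (r * sin (PI - x))) by
      (symmetry; apply is_derive_unique, H2).
    rewrite sin_PI_x; ring. }
  rewrite sin_primitive_0, Rminus_0_r in H.
  replace (PI - PI / 2) with (PI / 2) in H by field; lra.
Qed.

Lemma sin_primitive_shift_PI (f : R -> R) (x : R) :
  (forall y, continuous f y) ->
  sin_primitive f (x + PI) = sin_primitive f PI + sin_primitive (fun y => f (- y)) x.
Proof.
  intros Hf.
  assert (Hf' : forall y, continuous (fun y => f (- y)) y).
  { intros y; apply (continuous_comp Ropp f); [|apply Hf].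
    apply (ex_derive_continuous Ropp); auto_derive; exact I. }
  assert (H : sin_primitive f (x + PI) - sin_primitive (fun y => f (- y)) x =
    sin_primitive f (0 + PI) - sin_primitive (fun y => f (- y)) 0).
  { apply (derive_zero_eq (fun x => sin_primitive f (x + PI) - sin_primitive (fun y => f (- y)) x)).
    intros t.
    pose proof (is_derive_sin_primitive f (t + PI) Hf) as H1.
    pose proof (is_derive_sin_primitive _ t Hf') as H2; cbv beta in H2.
    set (g := sin_primitive (fun y => f (- y))) in *.
    auto_derive; [repeat split; eexists; eassumption|].
    replace (Derive (fun x => sin_primitive f x) (t + PI)) with (f (r * sin (t + PI))) by
      (symmetry; apply is_derive_unique, H1).
    replace (Derive (fun x => g x) t) with (f (- (r * sin t))) by
      (symmetry; apply is_derive_unique, H2).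
    replace (r * sin (t + PI)) with (- (r * sin t)) by (rewrite neg_sin; ring).
    ring. }
  rewrite sin_primitive_0, Rplus_0_l in H; lra.
Qed.

(** A period of sin is folded onto [0, pi/2] by sin (pi - u) = sin u and sin (u + pi) = - sin u, so
    the increment does not depend on the starting phase. *)
Lemma sin_primitive_shift (f : R -> R) (x : R) :
  (forall y, continuous f y) ->
  sin_primitive f (x + 2 * PI) = sin_primitive f x +
    2 * RInt (fun u => f (r * sin u) + f (- (r * sin u))) 0 (PI / 2).
Proof.
  intros Hf.
  assert (Hf' : forall y, continuous (fun y => f (- y)) y).
  { intros y; apply (continuous_comp Ropp f); [|apply Hf].
    apply (ex_derive_continuous Ropp); auto_derive; exact I. }
  replace (x + 2 * PI) with (x + PI + PI) by ring.
  rewrite sin_primitive_shift_PI, sin_primitive_shift_PI by assumption.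
  rewrite !sin_primitive_PI by assumption.
  replace (sin_primitive (fun y => f (- - y)) x) with (sin_primitive f x).
  2:{ apply RInt_ext; intros u _; rewrite Ropp_involutive; reflexivity. }
  rewrite (RInt_plus (fun u => f (r * sin u)) (fun u => f (- (r * sin u)))).
  - unfold sin_primitive, plus; simpl; ring.
  - apply ex_RInt_cont; intros y; apply continuous_scaled_sin, Hf.
  - apply ex_RInt_cont; intros y; apply (continuous_scaled_sin (fun y => f (- y))), Hf'.
Qed.

End SinPrimitive.

Lemma bounded_derive_onto (f df : R -> R) (m : R) :
  0 < m -> (forall x, is_derive f x (df x)) -> (forall x, m <= df x) ->
  forall y, exists a c, f a <= y <= f c.
Proof.
  intros Hm Hf Hd y.
  set (t := Rabs (y - f 0) / m).
  assert (Ht : 0 <= t) by (apply Rdiv_le_0_compat; [apply Rabs_pos|exact Hm]).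
  assert (Etm : t * m = Rabs (y - f 0)) by (unfold t; field; lra).
  pose proof (Rle_abs (y - f 0)); pose proof (Rle_abs (- (y - f 0))) as Hn.
  rewrite Rabs_Ropp in Hn.
  exists (- t), t; split.
  - destruct (mean_value f df 0 (- t) Hf) as [c [_ E]]; specialize (Hd c); nra.
  - destruct (mean_value f df 0 t Hf) as [c [_ E]]; specialize (Hd c); nra.
Qed.

(* In arc length [s] along the curve, with [k] the curvature, [tau = <x, T>]
   and [th] the direction angle of [T], the equation becomes this system. *)
Lemma symmetric_orbit (b : R) :
  0 < b < 2 / sqrt 3 ->
  exists (k tau th : R -> R) (P : R),
    0 < P /\
    (forall s, 0 < k s) /\
    (forall s, is_derive k s (k s * tau s)) /\
    (forall s, is_derive tau s (1 - b * k s - k s ^ 2)) /\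
    (forall s, is_derive th s (k s)) /\
    (forall s, k (s + P) = k s) /\
    (forall s, tau (s + P) = tau s) /\
    (forall s, th (s + P) = th s + PI) /\
    (exists s1 s2, k s1 <> k s2).
Proof.
  intros [Hb Hb3].
  (* The positive root of k^2 + b k = 1, the curvature of the circle solution. *)
  set (k0 := (sqrt (b ^ 2 + 4) - b) / 2).
  assert (Hsq : sqrt (b ^ 2 + 4) ^ 2 = b ^ 2 + 4) by (apply pow2_sqrt; nra).
  pose proof (sqrt_pos (b ^ 2 + 4)) as Hsp.
  assert (Hk0 : 0 < k0) by (unfold k0; nra).
  assert (Hk0e : k0 ^ 2 + b * k0 = 1) by (unfold k0; nra).
  (* This is where [b < 2 / sqrt 3] enters: if sqrt 3 k0 <= 1, then 3 (k0^2 + b k0) < 1 + 2. The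
     bound is equivalent to [dK 0 > / 2]. *)
  assert (H13 : 1 < 3 * k0 ^ 2).
  { assert (H3 : 0 < sqrt 3) by (apply sqrt_lt_R0; lra).
    assert (H32 : sqrt 3 ^ 2 = 3) by (apply pow2_sqrt; lra).
    assert (Hb' : b * sqrt 3 < 2).
    { replace 2 with (2 / sqrt 3 * sqrt 3) by (field; lra).
      apply Rmult_lt_compat_r; assumption. }
    destruct (Rlt_le_dec 1 (sqrt 3 * k0)) as [H|H]; [nra|exfalso].
    assert (3 * (k0 ^ 2 + b * k0) < 3); [|lra].
    replace (3 * (k0 ^ 2 + b * k0)) with
      ((sqrt 3 * k0) ^ 2 + (b * sqrt 3) * (sqrt 3 * k0)) by
      (transitivity (sqrt 3 ^ 2 * (k0 ^ 2 + b * k0)); [ring|rewrite H32; ring]).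
    assert (0 < sqrt 3 * k0) by nra.
    nra. }
  destruct (curvature_profile b k0 Hb Hk0 Hk0e) as
    [K [dK [HK [HdK [HD [Hc [HKd [HE [HK0 HdK0]]]]]]]]].
  assert (Hhalf : / 2 < dK 0).
  { rewrite HdK0.
    assert (Hs : 0 < sqrt (1 + k0 ^ 2)) by (apply sqrt_lt_R0; nra).
    assert (Hs2 : sqrt (1 + k0 ^ 2) ^ 2 = 1 + k0 ^ 2) by (apply pow2_sqrt; nra).
    apply Rmult_lt_reg_r with (sqrt (1 + k0 ^ 2)); [exact Hs|].
    replace (k0 / sqrt (1 + k0 ^ 2) * sqrt (1 + k0 ^ 2)) with k0 by (field; lra).
    nra. }
  destruct (quarter_angle_attained b k0 K dK Hb Hk0 Hk0e HK HdK HD Hc HKd HE HK0 Hhalf)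
    as [r [Hr Hq]].
  unfold quarter_angle in Hq.
  (* The derivative of arc length with respect to the phase: dtheta/dphi = [dK] divided by dtheta/ds
     = [K]. *)
  set (h := fun y => dK y / K y).
  assert (Hhp : forall y, 0 < h y) by (intros y; apply Rdiv_lt_0_compat; auto).
  assert (Hhc : forall y, continuous h y).
  { intros y; apply (continuous_mult dK (fun y => / K y)); [apply Hc|].
    apply (continuous_comp K Rinv); [apply (is_derive_continuous _ _ _ (HD y))|].
    apply (ex_derive_continuous Rinv); auto_derive; apply Rgt_not_eq, HK. }
  destruct (continuous_pos_lower_bound h (- r) r ltac:(lra) Hhc Hhp) as [m [Hm Hmh]].
  (* The arc length of one oscillation. [Phi] below is the phase as a function of arc length; it is
     defined on the whole line because [h >= m > 0] along the orbit. *)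
  set (P := 2 * RInt (fun u => h (r * sin u) + h (- (r * sin u))) 0 (PI / 2)).
  destruct (increasing_inverse (sin_primitive r h) (fun x => h (r * sin x)))
    as [Phi [HP1 [HP2 HP3]]].
  { intros x; apply is_derive_sin_primitive, Hhc. }
  { intros x; apply continuous_scaled_sin, Hhc. }
  { intros x; apply Hhp. }
  { apply bounded_derive_onto with (df := fun x => h (r * sin x)) (m := m); [exact Hm| |].
    - intros x; apply is_derive_sin_primitive, Hhc.
    - intros x; apply Hmh; pose proof (SIN_bound x); nra. }
  assert (HPs : forall s, Phi (s + P) = Phi s + 2 * PI).
  { intros s; rewrite <- (HP2 (Phi s + 2 * PI)); f_equal.
    rewrite sin_primitive_shift by exact Hhc.
    rewrite HP1; reflexivity. }
  assert (HPhi : forall s, is_derive Phi s (K (r * sin (Phi s)) / dK (r * sin (Phi s)))).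
  { intros s; replace (K (r * sin (Phi s)) / dK (r * sin (Phi s))) with
      (/ h (r * sin (Phi s))); [apply HP3|].
    unfold h; field; split; apply Rgt_not_eq; (apply HK || apply HdK). }
  exists (fun s => K (r * sin (Phi s))), (fun s => r * cos (Phi s)),
    (fun s => sin_primitive r dK (Phi s)), P.
  split; [|split; [|split; [|split; [|split; [|split; [|split; [|split]]]]]]].
  - unfold P; apply Rmult_lt_0_compat; [lra|].
    pose proof PI_RGT_0.
    apply RInt_gt_0; [lra| |].
    + intros x _; pose proof (Hhp (r * sin x)); pose proof (Hhp (- (r * sin x))); lra.
    + intros x _; apply (continuous_plus (fun u => h (r * sin u)));
        [apply continuous_scaled_sin, Hhc|].
      apply (continuous_scaled_sin (fun y => h (- y))).
      intros y; apply (continuous_comp Ropp h); [|apply Hhc].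
      apply (ex_derive_continuous Ropp); auto_derive; exact I.
  - intros s; apply HK.
  - intros s; pose proof (HPhi s) as H1; pose proof (HD (r * sin (Phi s))) as H2.
    auto_derive; [repeat split; eexists; eassumption|].
    replace (Derive (fun x => K x) (r * sin (Phi s))) with (dK (r * sin (Phi s))) by
      (symmetry; apply is_derive_unique, H2).
    replace (Derive (fun x => Phi x) s) with (K (r * sin (Phi s)) / dK (r * sin (Phi s))) by
      (symmetry; apply is_derive_unique, H1).
    field; apply Rgt_not_eq, HdK.
  - intros s; pose proof (HPhi s) as H1; pose proof (HKd (r * sin (Phi s))) as H2.
    auto_derive; [eexists; eassumption|].
    replace (Derive (fun x => Phi x) s) with (K (r * sin (Phi s)) / dK (r * sin (Phi s))) by
      (symmetry; apply is_derive_unique, H1).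
    pose proof (HdK (r * sin (Phi s))) as H3.
    (* The derivative of tau is - y K / dK with y = r sin Phi, which [K_dK] turns into 1 - b K -
       K^2. *)
    apply Rmult_eq_reg_r with (dK (r * sin (Phi s))); [|lra].
    field_simplify; [|lra].
    lra.
  - intros s; pose proof (HPhi s) as H1.
    pose proof (is_derive_sin_primitive r dK (Phi s) Hc) as H2.
    auto_derive; [repeat split; eexists; eassumption|].
    replace (Derive (fun x => sin_primitive r dK x) (Phi s)) with (dK (r * sin (Phi s))) by
      (symmetry; apply is_derive_unique, H2).
    replace (Derive (fun x => Phi x) s) with (K (r * sin (Phi s)) / dK (r * sin (Phi s))) by
      (symmetry; apply is_derive_unique, H1).
    field; apply Rgt_not_eq, HdK.
  - intros s; rewrite HPs, sin_plus, sin_2PI, cos_2PI; do 2 f_equal; ring.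
  - intros s; rewrite HPs, cos_plus, sin_2PI, cos_2PI; ring.
  - intros s; rewrite HPs, sin_primitive_shift by exact Hc; rewrite Hq; field.
  (* The arc lengths at phases 0 and pi/2, where the curvature is [K 0] and [K r]. *)
  - exists (sin_primitive r h 0), (sin_primitive r h (PI / 2)).
    rewrite !HP2, sin_0, sin_PI2.
    apply Rlt_not_eq, (derive_pos_lt K dK); auto; lra.
Qed.

(** * The curve *)

Section Curve.

Variables (lambda P : R) (k tau th : R -> R).
Hypothesis P_pos : 0 < P.
Hypothesis k_pos : forall s, 0 < k s.
Hypothesis is_derive_k : forall s, is_derive k s (k s * tau s).
Hypothesis is_derive_tau : forall s, is_derive tau s (1 + lambda * k s - k s ^ 2).
Hypothesis is_derive_th : forall s, is_derive th s (k s).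
Hypothesis k_shift : forall s, k (s + P) = k s.
Hypothesis tau_shift : forall s, tau (s + P) = tau s.
Hypothesis th_shift : forall s, th (s + P) = th s + PI.

(* The polynomials in k, tau, cos th and sin th are closed under d/ds, which
   makes all of them smooth. *)
Inductive expr : Type :=
| Const (c : R) | Curv | Tau | Cos | Sin
| Add (e f : expr) | Mul (e f : expr).

Fixpoint eval (e : expr) (s : R) : R :=
  match e with
  | Const c => c
  | Curv => k s
  | Tau => tau s
  | Cos => cos (th s)
  | Sin => sin (th s)
  | Add e f => eval e s + eval f s
  | Mul e f => eval e s * eval f s
  end.

Fixpoint diff (e : expr) : expr :=
  match e with
  | Const _ => Const 0
  | Curv => Mul Curv Tau
  | Tau => Add (Const 1) (Add (Mul (Const lambda) Curv) (Mul (Const (-1)) (Mul Curv Curv)))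
  | Cos => Mul (Const (-1)) (Mul Sin Curv)
  | Sin => Mul Cos Curv
  | Add e f => Add (diff e) (diff f)
  | Mul e f => Add (Mul (diff e) f) (Mul e (diff f))
  end.

Lemma is_derive_eval (e : expr) (s : R) : is_derive (eval e) s (eval (diff e) s).
Proof.
  induction e as [c| | | | |e IHe f IHf|e IHe f IHf]; simpl.
  - apply (is_derive_const c).
  - apply is_derive_k.
  - replace (1 + (lambda * k s + -1 * (k s * k s))) with (1 + lambda * k s - k s ^ 2) by ring.
    apply is_derive_tau.
  - pose proof (is_derive_th s) as H.
    auto_derive; [eexists; exact H|].
    replace (Derive (fun x => th x) s) with (k s) by (symmetry; apply is_derive_unique, H).
    ring.
  - pose proof (is_derive_th s) as H.
    auto_derive; [eexists; exact H|].
    replace (Derive (fun x => th x) s) with (k s) by (symmetry; apply is_derive_unique, H).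
    ring.
  - apply (is_derive_plus (eval e)); assumption.
  - apply (is_derive_mult (eval e) (eval f)); try assumption; exact Rmult_comm.
Qed.

Lemma Derive_n_eval (e : expr) (n : nat) (s : R) :
  Derive_n (eval e) n s = eval (Nat.iter n diff e) s.
Proof.
  revert s; induction n as [|n IHn]; intros s; [reflexivity|].
  simpl; rewrite (Derive_ext _ _ s IHn).
  apply is_derive_unique, is_derive_eval.
Qed.

Lemma smooth_eval (e : expr) : smooth_function (eval e).
Proof.
  intros [|n] s; simpl; [exact I|].
  apply ex_derive_ext with (eval (Nat.iter n diff e)).
  - intros t; symmetry; apply Derive_n_eval.
  - eexists; apply is_derive_eval.
Qed.

(* x = tau T + (lambda - k) N *)
Definition abscissa : expr :=
  Add (Mul Tau Cos) (Mul (Add Curv (Const (- lambda))) Sin).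
Definition ordinate : expr :=
  Add (Mul Tau Sin) (Mul (Add (Const lambda) (Mul (Const (-1)) Curv)) Cos).
Definition curve (s : R) : plane := (eval abscissa s, eval ordinate s).

(** With T' = k N and N' = - k T, the derivative of tau T + (lambda - k) N is (tau' - lambda k +
    k^2) T + (k tau - k') N, which the system reduces to T. *)
Lemma is_derive_abscissa (s : R) : is_derive (eval abscissa) s (cos (th s)).
Proof.
  replace (cos (th s)) with (eval (diff abscissa) s); [apply is_derive_eval|].
  simpl; ring.
Qed.

Lemma is_derive_ordinate (s : R) : is_derive (eval ordinate) s (sin (th s)).
Proof.
  replace (sin (th s)) with (eval (diff ordinate) s); [apply is_derive_eval|].
  simpl; ring.
Qed.

Lemma velocity_curve (s : R) : velocity curve s = (cos (th s), sin (th s)).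
Proof.
  unfold velocity; f_equal; apply is_derive_unique;
    [apply is_derive_abscissa|apply is_derive_ordinate].
Qed.

(** The coordinates of the point in the frame (T, N) repeat after [P], while the frame itself turns
    by pi. *)
Lemma curve_shift (s : R) : curve (s + P) = rotation PI (curve s).
Proof.
  unfold curve, rotation; simpl.
  rewrite k_shift, tau_shift, th_shift, neg_cos, neg_sin, cos_PI, sin_PI.
  f_equal; ring.
Qed.

Lemma curve_period (s : R) : curve (s + 2 * P) = curve s.
Proof.
  replace (s + 2 * P) with (s + P + P) by ring.
  rewrite !curve_shift; unfold rotation; simpl; rewrite cos_PI, sin_PI.
  unfold curve; simpl; f_equal; ring.
Qed.

(* The component of the curve along the outward normal at [s] decreases
   strictly as long as the tangent has turned by less than pi. *)
Lemma curve_injective_half_turn (s t : R) :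
  s < t -> th t - th s <= PI -> curve s <> curve t.
Proof.
  intros Hst Hth E.
  set (g := fun u => eval abscissa u * sin (th s) - eval ordinate u * cos (th s)).
  assert (Hg : forall u, is_derive g u (sin (th s - th u))).
  { intros u; pose proof (is_derive_abscissa u) as H1.
    pose proof (is_derive_ordinate u) as H2.
    unfold g; set (a := eval abscissa) in *; set (c := eval ordinate) in *.
    auto_derive; [repeat split; eexists; eassumption|].
    replace (Derive (fun x => a x) u) with (cos (th u)) by
      (symmetry; apply is_derive_unique, H1).
    replace (Derive (fun x => c x) u) with (sin (th u)) by
      (symmetry; apply is_derive_unique, H2).
    rewrite sin_minus; ring. }
  (* Having [c] strictly inside keeps [th c - th s] strictly between 0 and pi even when the total
     turn equals pi. *)
  destruct (mean_value_lt g _ s t Hst Hg) as [c [Hc Eg]].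
  assert (Hlt : forall u v, u < v -> th u < th v) by
    (intros u v; apply (derive_pos_lt th k); assumption).
  pose proof (Hlt s c ltac:(lra)); pose proof (Hlt c t ltac:(lra)).
  assert (Hsin : 0 < sin (th c - th s)) by (apply sin_gt_0; lra).
  replace (th s - th c) with (- (th c - th s)) in Eg by ring.
  rewrite sin_neg in Eg.
  pose proof (f_equal fst E : eval abscissa s = eval abscissa t) as E1.
  pose proof (f_equal snd E : eval ordinate s = eval ordinate t) as E2.
  assert (g t = g s) by (unfold g; rewrite E1, E2; reflexivity).
  nra.
Qed.

(** The tangent turns by 2 pi over the period [2 * P], so one of the arcs from [s] to [t] and from
    [t] to [s + 2 * P] turns by at most pi. *)
Lemma curve_injective (s t : R) :
  0 <= s < 2 * P -> 0 <= t < 2 * P -> curve s = curve t -> s = t.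
Proof.
  assert (Hlt : forall u v, u < v -> th u < th v) by
    (intros u v; apply (derive_pos_lt th k); assumption).
  assert (H : forall s t, 0 <= s -> s < t -> t < 2 * P -> curve s <> curve t).
  { clear s t; intros s t Hs Hst Ht.
    destruct (Rle_lt_dec (th t - th s) PI) as [H|H].
    - apply curve_injective_half_turn; assumption.
    - intros E; apply (curve_injective_half_turn t (s + 2 * P)).
      + lra.
      + replace (s + 2 * P) with (s + P + P) by ring; rewrite !th_shift; lra.
      + rewrite curve_period; symmetry; exact E. }
  intros Hs Ht E.
  destruct (Rtotal_order s t) as [L|[L|L]]; [|exact L|]; exfalso.
  - apply (H s t); lra || assumption.
  - apply (H t s); lra || (symmetry; assumption).
Qed.

Lemma curve_closed_embedded : closed_embedded_curve curve.
Proof.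
  split; [split; apply smooth_eval|split].
  - intros s; rewrite velocity_curve; intros E; injection E as E1 E2.
    pose proof (sin2_cos2 (th s)) as H; rewrite E1, E2 in H; unfold Rsqr in H; lra.
  - exists (2 * P); split; [lra|split].
    + apply curve_period.
    + apply curve_injective.
Qed.

(* Differentiating |x - c|^2 = r^2 twice gives k <x - c, N> = -1 and
   <x - c, T> = 0, so k^2 r^2 = 1. *)
Lemma circle_constant_curvature (c : plane) (r : R) :
  (forall s, (fst (curve s) - fst c) ^ 2 + (snd (curve s) - snd c) ^ 2 = r ^ 2) ->
  forall s, k s ^ 2 * r ^ 2 = 1.
Proof.
  intros Hc.
  set (e := Add (Mul (Add abscissa (Const (- fst c))) Cos)
    (Mul (Add ordinate (Const (- snd c))) Sin)).
  assert (H0 : forall s, eval e s = 0).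
  { intros s.
    (* [q] encodes |x - c|^2, and its derivative is twice [e], which encodes <x - c, T>. *)
    set (q := Add (Mul (Add abscissa (Const (- fst c))) (Add abscissa (Const (- fst c))))
      (Mul (Add ordinate (Const (- snd c))) (Add ordinate (Const (- snd c))))).
    assert (Hq : is_derive (eval q) s 0).
    { assert (Eq : forall t, r ^ 2 = eval q t) by
        (intros t; rewrite <- (Hc t); simpl; ring).
      apply (is_derive_ext (fun _ => r ^ 2) _ s _ Eq), (is_derive_const (r ^ 2)). }
    apply is_derive_unique in Hq.
    rewrite (is_derive_unique _ _ _ (is_derive_eval q s)) in Hq.
    simpl in Hq |- *; lra. }
  intros s.
  assert (He : is_derive (eval e) s 0).
  { apply (is_derive_ext (fun _ => 0)); [intros t; symmetry; apply H0|].
    apply (is_derive_const 0). }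
  apply is_derive_unique in He.
  rewrite (is_derive_unique _ _ _ (is_derive_eval e s)) in He.
  specialize (H0 s); specialize (Hc s).
  assert (Ha : eval (diff abscissa) s = cos (th s)) by
    (rewrite <- (is_derive_unique _ _ _ (is_derive_eval abscissa s));
     apply is_derive_unique, is_derive_abscissa).
  assert (Ho : eval (diff ordinate) s = sin (th s)) by
    (rewrite <- (is_derive_unique _ _ _ (is_derive_eval ordinate s));
     apply is_derive_unique, is_derive_ordinate).
  change ((eval abscissa s - fst c) ^ 2 + (eval ordinate s - snd c) ^ 2 = r ^ 2) in Hc.
  unfold e in H0, He; cbn [diff eval] in H0, He; rewrite Ha, Ho in He.
  pose proof (sin2_cos2 (th s)) as Hsc; unfold Rsqr in Hsc.
  set (X := eval abscissa s) in *; set (Y := eval ordinate s) in *.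
  set (C := cos (th s)) in *; set (S := sin (th s)) in *.
  (* [n] is <x - c, N>; as the tangential component vanishes, its square is all of |x - c|^2. *)
  set (n := - (X - fst c) * S + (Y - snd c) * C).
  assert (Hn : k s * n = -1) by (unfold n; lra).
  assert (Hn2 : n ^ 2 = r ^ 2).
  { rewrite <- Hc; unfold n.
    transitivity (((X - fst c) ^ 2 + (Y - snd c) ^ 2) * (S * S + C * C) -
      ((X - fst c) * C + (Y - snd c) * S) ^ 2); [ring|].
    replace ((X - fst c) * C + (Y - snd c) * S) with 0 by lra.
    rewrite Hsc; ring. }
  rewrite <- Hn2; replace (k s ^ 2 * n ^ 2) with ((k s * n) ^ 2) by ring.
  rewrite Hn; ring.
Qed.

Lemma curve_not_circle :
  (exists s1 s2, k s1 <> k s2) -> ~ is_circle (image curve).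
Proof.
  intros [s1 [s2 Hk]] [c [r [Hr Hc]]]; apply Hk.
  assert (H : forall s, k s ^ 2 * r ^ 2 = 1).
  { apply (circle_constant_curvature c); intros s; apply Hc; exists s; reflexivity. }
  pose proof (H s1) as H1; pose proof (H s2) as H2.
  pose proof (k_pos s1); pose proof (k_pos s2).
  assert (E : k s1 ^ 2 = k s2 ^ 2).
  { apply Rmult_eq_reg_r with (r ^ 2); [lra|nra]. }
  nra.
Qed.

(** With N the rotation of T by [PI / 2], the construction of the curve gives <x, N> = lambda -
    k. *)
Lemma curve_solves : solves_equation lambda curve.
Proof.
  split.
  - intros s; rewrite velocity_curve; unfold inner; simpl.
    pose proof (sin2_cos2 (th s)) as H; unfold Rsqr in H; lra.
  - exists (fun s => rotation (PI / 2) (velocity curve s)), k.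
    split; [exists (PI / 2); split; [left; reflexivity|reflexivity]|split].
    + intros s; rewrite velocity_curve; unfold rotation; simpl.
      rewrite cos_PI2, sin_PI2; split; simpl.
      * apply (is_derive_ext (eval Cos)).
        -- intros t; symmetry; apply (f_equal fst (velocity_curve t)).
        -- replace (k s * (0 * cos (th s) - 1 * sin (th s))) with (eval (diff Cos) s) by
             (simpl; ring).
           apply is_derive_eval.
      * apply (is_derive_ext (eval Sin)).
        -- intros t; symmetry; apply (f_equal snd (velocity_curve t)).
        -- replace (k s * (1 * cos (th s) + 0 * sin (th s))) with (eval (diff Sin) s) by
             (simpl; ring).
           apply is_derive_eval.
    + intros s; rewrite velocity_curve; unfold rotation, inner; simpl.
      rewrite cos_PI2, sin_PI2.
      pose proof (sin2_cos2 (th s)) as H; unfold Rsqr in H.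
      transitivity (lambda - (lambda - k s) * (sin (th s) * sin (th s) + cos (th s) * cos (th s)));
        [rewrite H; ring|ring].
Qed.

(** The rotation by pi acts on the curve as the shift by [P]; being an involution, it gives both
    directions. *)
Lemma curve_symmetric : admits_symmetry 2 (image curve).
Proof.
  split; [lia|]; intros p.
  replace (2 * PI / INR 2) with PI by (simpl; field).
  assert (Hrr : rotation PI (rotation PI p) = p).
  { unfold rotation; destruct p; simpl; rewrite cos_PI, sin_PI; f_equal; ring. }
  split; intros [s Hs].
  - exists (s + P); rewrite curve_shift, Hs; exact Hrr.
  - exists (s + P); rewrite curve_shift, Hs; reflexivity.
Qed.

End Curve.

Theorem theorem1p2 :
  forall lambda : R, - (2 / sqrt 3) < lambda < 0 ->
  exists x : R -> plane,
    closed_embedded_curve x /\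
    ~ is_circle (image x) /\
    solves_equation lambda x /\
    admits_symmetry 2 (image x).
Proof.
  intros lambda Hl.
  destruct (symmetric_orbit (- lambda) ltac:(lra)) as
    [k [tau [th [P [HP [Hk [Dk [Dtau [Dth [Sk [Stau [Sth Hne]]]]]]]]]]]].
  assert (Dtau' : forall s, is_derive tau s (1 + lambda * k s - k s ^ 2)).
  { intros s; replace (1 + lambda * k s - k s ^ 2) with (1 - - lambda * k s - k s ^ 2) by ring.
    apply Dtau. }
  exists (curve lambda k tau th); split; [|split; [|split]].
  - apply (curve_closed_embedded lambda P); assumption.
  - apply curve_not_circle; assumption.
  - apply curve_solves; assumption.
  - apply (curve_symmetric lambda P); assumption.
Qed.
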